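(* Let $(A,B)$ be a basic instance such that $L(A)\setminus\{1\}$ only contains primes. Then the set of solutions of $(A,B)$ can be computed in time $O(|B|^4)$, and there are at most $|B|/|A|$ solutions.
   Context: A sum of cycles is a finite digraph that is a disjoint union of directed cycles, considered up to isomorphism. $C_\ell$ is the directed cycle of length $\ell$, $A(\ell)$ is the number of cycles of length $\ell$ in $A$, $|A|=\sum_{\ell\ge1}\ell A(\ell)$ is the number of vertices, and $L(A)=\{\ell : A(\ell)>0\}$. The product $AB$ is the direct product of digraphs, i.e. the distributive product (over disjoint union) with $C_aC_b=\gcd(a,b)\,C_{\operatorname{lcm}(a,b)}$ ($nC_\ell$ denotes $n$ disjoint copies of $C_\ell$). An instance is a pair $(A,B)$ of non-empty sums of cycles; a solution of $(A,B)$ is a sum of cycles $X$ with $AX=B$. The instance is basic if every element of $L(B)$ divides $\operatorname{lcm}L(A)$. *)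

(* Defs.v *)
From HB Require Import structures.
From mathcomp Require Import all_boot all_order all_algebra.
From mathcomp Require Import finmap multiset.

Set Implicit Arguments.
Unset Strict Implicit.
Unset Printing Implicit Defensive.

Local Open Scope nat_scope.
Local Open Scope fset_scope.
Local Open Scope mset_scope.

(** * Sums of cycles *)

(* A disjoint union of directed cycles is determined up to isomorphism by the
   finite multiset of its (positive) cycle lengths, so that isomorphism is
   Leibniz equality here. *)
Record cycsum := CycSum {
  lengths : {mset nat};
  _ : lengths 0 == 0
}.

HB.instance Definition _ := [isSub for lengths].
HB.instance Definition _ := [Choice of cycsum by <:].

(* A(l) *)
Definition ncycles (A : cycsum) (l : nat) : nat := lengths A l.
Coercion ncycles : cycsum >-> Funclass.

(* L(A) *)
Definition supp (A : cycsum) : {fset nat} := finsupp (lengths A).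

(* |A|, the number of vertices *)
Definition nvertices (A : cycsum) : nat := \sum_(l <- supp A) l * A l.

Definition nonempty (A : cycsum) : Prop := lengths A <> mset0.

(* The distributive extension of C_a C_b = gcd(a,b) C_lcm(a,b); the iterated
   sums range over the cycles of A and B, with repetition. *)
Definition mset_mul (A B : {mset nat}) : {mset nat} :=
  \big[msetD/mset0]_(a <- enum_mset A) \big[msetD/mset0]_(b <- enum_mset B)
    msetn (gcdn a b) (lcmn a b).

Fact mset_mul0 (A B : cycsum) : mset_mul (lengths A) (lengths B) 0 == 0.
Proof.
have pos (C : cycsum) l : l \in enum_mset (lengths C) -> 0 < l.
  by case: C => C C0 /=; case: l => //; rewrite in_mset (eqP C0).
have big0 (s : seq nat) (F : nat -> {mset nat}) :
    {in s, forall a, F a 0 = 0} -> (\big[msetD/mset0]_(a <- s) F a) 0 = 0.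
  move=> F0; rewrite big_seq; apply: (big_ind (fun C : {mset nat} => C 0 = 0)) => //.
  - by rewrite mset0E.
  - by move=> C D C0 D0; rewrite msetE2 C0 D0.
apply/eqP/big0 => a /pos a0; apply: big0 => b /pos b0.
by rewrite msetnE ltn_eqF // lcmn_gt0 a0 b0.
Qed.

Definition mul (A B : cycsum) : cycsum := CycSum (mset_mul0 A B).

Definition basic_instance (A B : cycsum) : Prop :=
  [/\ nonempty A, nonempty B
    & {in supp B, forall l, l %| \big[lcmn/1]_(k <- supp A) k}].

Definition solution (A B X : cycsum) : Prop := mul A X = B.

Definition solution_set (A B : cycsum) (S : {fset cycsum}) : Prop :=
  forall X, X \in S <-> solution A B X.

(** * Word RAM

   The memory consists of arrays of natural numbers. Array names are constants
   of the program, hence a program uses finitely many arrays, and only indices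
   are computed; scalar variables are cells at constant indices. Every
   operation has unit cost. To keep unit cost meaningful, all values and
   indices occurring in a run must be at most a bound [W]: an execution that
   exceeds it has no derivation. *)

Inductive binop := Add | Sub | Mul | Div | Mod | Eq | Le.

Definition binop_sem (o : binop) (m n : nat) : nat :=
  match o with
  | Add => m + n
  | Sub => m - n
  | Mul => m * n
  | Div => m %/ n
  | Mod => m %% n
  | Eq => (m == n)
  | Le => (m <= n)
  end.

Inductive expr :=
  | Lit of nat
  | Get of nat & expr
  | Op of binop & expr & expr.

Inductive prog :=
  | Skip
  | Set_ of nat & expr & expr
  | Seq of prog & prog
  | If of expr & prog & prog
  | While of expr & prog.

Definition memory := nat -> nat -> nat.

Definition update (s : memory) (a i v : nat) : memory :=
  fun a' i' => if (a' == a) && (i' == i) then v else s a' i'.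

Definition word (W n : nat) : option nat := if n <= W then Some n else None.

Fixpoint eval (W : nat) (s : memory) (e : expr) : option nat :=
  match e with
  | Lit n => word W n
  | Get a e1 => obind (fun i => word W (s a i)) (eval W s e1)
  | Op o e1 e2 =>
      obind (fun m => obind (fun n => word W (binop_sem o m n)) (eval W s e2))
        (eval W s e1)
  end.

Fixpoint cost (e : expr) : nat :=
  match e with
  | Lit _ => 1
  | Get _ e1 => (cost e1).+1
  | Op _ e1 e2 => (cost e1 + cost e2).+1
  end.

(* [exec W P s t s']: from memory [s], the program [P] halts in memory [s']
   after [t] unit-cost steps. *)
Inductive exec (W : nat) : prog -> memory -> nat -> memory -> Prop :=
  | ExecSkip s : exec W Skip s 1 s
  | ExecSet a ei ev s i v :
      eval W s ei = Some i -> eval W s ev = Some v ->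
      exec W (Set_ a ei ev) s (cost ei + cost ev).+1 (update s a i v)
  | ExecSeq P Q s t s' u s'' :
      exec W P s t s' -> exec W Q s' u s'' -> exec W (Seq P Q) s (t + u) s''
  | ExecIfTrue e P Q s n t s' :
      eval W s e = Some n.+1 -> exec W P s t s' ->
      exec W (If e P Q) s (cost e + t).+1 s'
  | ExecIfFalse e P Q s t s' :
      eval W s e = Some 0 -> exec W Q s t s' ->
      exec W (If e P Q) s (cost e + t).+1 s'
  | ExecWhileTrue e P s n t s' u s'' :
      eval W s e = Some n.+1 -> exec W P s t s' ->
      exec W (While e P) s' u s'' ->
      exec W (While e P) s (cost e + t + u).+1 s''
  | ExecWhileFalse e P s :
      eval W s e = Some 0 -> exec W (While e P) s (cost e).+1 s.

(** * Computing the set of solutions *)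

(* A sum of cycles is encoded by a list of the lengths of its cycles, in any
   order and with repetition, preceded by the number of cycles. *)
Definition lists (x : seq nat) (X : cycsum) : Prop := seq_mset x = lengths X.

Definition encode (x : seq nat) : seq nat := size x :: x.

(* [A] and [B] are given in arrays 0 and 1; all other cells contain 0. *)
Definition input (a b : seq nat) : memory :=
  fun k i => match k with
    | 0 => nth 0 (encode a) i
    | 1 => nth 0 (encode b) i
    | _ => 0
    end.

(* Array 2 starts with the number of solutions, followed by the concatenated
   codes of the solutions, each of them listed exactly once. *)
Definition outputs (s : memory) (S : {fset cycsum}) : Prop :=
  exists (Xs : seq cycsum) (xs : seq (seq nat)),
    let code := size xs :: flatten [seq encode x | x <- xs] in
    [/\ perm_eq Xs S,
        [seq seq_mset x | x <- xs] = [seq lengths X | X <- Xs]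
      & mkseq (s 2) (size code) = code].

(* One program outputs the set of solutions of every instance in [I], in time
   O(f). The word bound (|A| + |B|)^w amounts to words of O(log(|A| + |B|))
   bits. *)
Definition solutions_computable_in
    (I : cycsum -> cycsum -> Prop) (f : cycsum -> cycsum -> nat) : Prop :=
  exists (P : prog) (w c : nat), forall A B : cycsum, I A B ->
    exists S : {fset cycsum}, solution_set A B S /\
    forall a b : seq nat, lists a A -> lists b B ->
      exists (t : nat) (s : memory),
        [/\ exec ((nvertices A + nvertices B) ^ w) P (input a b) t s,
            t <= c * f A B
          & outputs s S].

(* Main.v *)
Require Import Defs.
From mathcomp Require Import all_boot all_order all_algebra.
From mathcomp Require Import finmap multiset.
From mathcomp Require Import zify.

(** For a sum of cycles [X] and a number [d], let [cfixed X d] be the number of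
    vertices fixed by the [d]-th iterate of the successor map, that is the sum
    of the lengths of the cycles of [X] whose length divides [d]; for [d = 0]
    it is the number of vertices. This count is multiplicative
    ([cfixed_mul]), and its values for [d <= |B|] tell [B] from any other sum of
    cycles ([cfixed_inj]). Hence [AX = B] is equivalent to the numerical
    equations [cfixed A d * cfixed X d = cfixed B d] for [d <= |B|]
    ([solutionP]).

    Let [d > 1]. If [cfixed A d > 0], the equation at [d] gives [cfixed X d], and
    so [X d] from the numbers [X l] with [l < d]. If [cfixed A d = 0], no length
    in [A] divides [d], and then [X d = 0]: otherwise some multiple of [d] is a
    length of [B], a prime factor of [d] divides the lcm of the lengths of [A],
    and as these lengths are primes or [1] one of them divides [d]
    ([solution_cycle_dvd]). So a solution [X] is determined by the single number
    [X 1] ([solution_inj]). Every solution has [|B| / |A|] vertices, and the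
    number of its loops lies between [0] and [|B| / |A|] but misses the value
    [|B| / |A| - 1], as a single vertex cannot form a longer cycle. This bounds
    the number of solutions ([solutions_bound]).

    The program [solver] tries each [x] from [0] to [|B|] as the value of [X 1]:
    it fills an array by the recurrence [next_count], tests the numerical
    equations, and prints the array as a list of cycles if they hold. Each of
    the at most [|B| + 1] rounds takes time [O(|B|^2)], since an instance where
    [A] has more than [|B|] cycles is discarded at the start ([runs_solver]).
    The program is verified in a Hoare logic for total correctness with time
    bounds ([runs]). *)

Set Implicit Arguments.
Unset Strict Implicit.
Unset Printing Implicit Defensive.
Local Open Scope mset_scope.
Local Open Scope nat_scope.

(** * Vertices fixed by the iterates of the successor map *)

Definition fixed (s : seq nat) (d : nat) : nat := \sum_(l <- s | l %| d) l.

(** The same sum when the cycles are given by the number [F l] of cycles of each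
    length [l < n]. *)
Definition fixed_upto (n : nat) (F : nat -> nat) (d : nat) : nat :=
  \sum_(l < n | l %| d) l * F l.

Lemma fixed_count s d n : (forall l, l \in s -> l %| d -> l < n) ->
  fixed s d = fixed_upto n (fun l => count_mem l s) d.
Proof.
rewrite /fixed /fixed_upto; elim: s => [|a s IH] H.
  by rewrite big_nil big1 // => l _; rewrite muln0.
rewrite big_cons IH; last by move=> l ls; apply: H; rewrite inE ls orbT.
under [in RHS]eq_bigr => l _ do rewrite /= mulnDr.
rewrite big_split /=; case: ifP => ad; last first.
  rewrite [X in _ = X + _]big1 // => l ld; case: eqP => [E|]; last by rewrite muln0.
  by rewrite -E ad in ld.
have an : a < n by apply: H; rewrite ?inE ?eqxx.
congr (_ + _); rewrite (bigD1 (Ordinal an)) //= eqxx muln1 big1 ?addn0 // => l.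
by case/andP=> _ /eqP ne; case: eqP => [E|]; rewrite ?muln0 //; case: ne;
  apply: val_inj.
Qed.

Lemma fixed_seq_mset s d : fixed (seq_mset s) d = fixed s d.
Proof. exact: perm_big (perm_eq_seq_mset s). Qed.

Lemma fixedD (A B : {mset nat}) d :
  fixed (A `+` B)%mset d = fixed A d + fixed B d.
Proof.
rewrite /fixed -big_cat; apply: perm_big; apply/allP => l _ /=.
by rewrite count_cat !count_mem_mset msetE2.
Qed.

Lemma fixed_sum (I : Type) (r : seq I) (F : I -> {mset nat}) d :
  fixed (\big[msetD/mset0]_(i <- r) F i)%mset d = \sum_(i <- r) fixed (F i) d.
Proof.
apply: (big_morph (fun C : {mset nat} => fixed C d)) => [A B|]; first exact: fixedD.
by rewrite /fixed big_mset0.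
Qed.

(** The cycles [a] and [b] produce [gcd(a, b)] cycles of length [lcm(a, b)], which
    divides [d] exactly when [a] and [b] do; their total length is [a * b]. *)
Lemma fixed_mul (A B : {mset nat}) d :
  fixed (mset_mul A B) d = fixed A d * fixed B d.
Proof.
rewrite fixed_sum [fixed A d]/fixed big_distrl /= [RHS]big_mkcond /=.
apply: eq_bigr => a _; rewrite fixed_sum /fixed.
have H b : \sum_(l <- msetn (gcdn a b) (lcmn a b) | l %| d) l =
           if (a %| d) && (b %| d) then a * b else 0.
  rewrite sum_mset -dvdn_lcm [LHS](_ : _ = fixed (msetn (gcdn a b) (lcmn a b)) d).
    rewrite /fixed big_msetn Monoid.iteropE iter_addn addn0.
    by rewrite muln_lcm_gcd.
  by rewrite /fixed sum_mset.
under eq_bigr => b _ do rewrite H.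
case: ifP => ad /=; last by rewrite big1.
by rewrite big_distrr /= -big_mkcond.
Qed.

Definition cfixed (A : cycsum) := fixed (lengths A).

Lemma cfixed_mul A X d : cfixed (Defs.mul A X) d = cfixed A d * cfixed X d.
Proof. exact: fixed_mul. Qed.

Lemma nvertices_cfixed A : nvertices A = cfixed A 0.
Proof.
rewrite /cfixed /fixed sum_mset; apply: eq_big => [l|l _]; first by rewrite dvdn0.
exact: mulnC.
Qed.

Lemma cfixed_upto (A : cycsum) d n : (forall l, A l != 0 -> l %| d -> l < n) ->
  cfixed A d = fixed_upto n A d.
Proof.
move=> H; rewrite /cfixed (@fixed_count _ _ n).
  by apply: eq_bigr => l _; rewrite count_mem_mset.
by move=> l lA; apply: H; rewrite /ncycles mset_neq0.
Qed.

Lemma cfixed_ltS A d : 0 < d -> cfixed A d = fixed_upto d.+1 A d.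
Proof. by move=> d0; apply: cfixed_upto => l _ /(dvdn_leq d0). Qed.

Lemma fixed_uptoS n F d :
  fixed_upto n.+1 F d = fixed_upto n F d + (if n %| d then n * F n else 0).
Proof. by rewrite /fixed_upto big_mkcond big_ord_recr -big_mkcond. Qed.

Lemma cfixed_rec A d : 0 < d -> cfixed A d = fixed_upto d A d + d * A d.
Proof. by move=> d0; rewrite cfixed_ltS // fixed_uptoS dvdnn. Qed.

Lemma ncycles0 (A : cycsum) : A 0 = 0.
Proof. by case: A => C C0; apply/eqP. Qed.

Lemma leq_nvertices (A : cycsum) l : l * A l <= nvertices A.
Proof.
case: (posnP (A l)) => [->|Al]; first by rewrite muln0.
rewrite /nvertices (big_fsetD1 l) /=; last by rewrite /supp msuppE in_mset.
exact: leq_addr.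
Qed.

Lemma ncycles_big (A : cycsum) l : nvertices A < l -> A l = 0.
Proof.
have := leq_nvertices A l; case: (A l) => // k; nia.
Qed.

Lemma cfixed_nvertices A d n : nvertices A < n -> cfixed A d = fixed_upto n A d.
Proof.
move=> An; apply: cfixed_upto => l Al _; apply: leq_ltn_trans An.
by rewrite leqNgt; apply: contra Al => /ncycles_big ->.
Qed.

Lemma cycsumP (A B : cycsum) : A =1 B <-> A = B.
Proof. by split=> [H|-> //]; apply/val_inj/msetP. Qed.

Lemma fixed_upto_eq n F G d : (forall l, l < n -> F l = G l) ->
  fixed_upto n F d = fixed_upto n G d.
Proof. by move=> H; apply: eq_bigr => l _; rewrite H. Qed.

(** Subtracting the contribution of the proper divisors of [d] from [cfixed A d]
    leaves [d * A d]. The equation at [0] says that both sides have the same number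
    of vertices, so that neither has a cycle longer than [|B|]. *)
Lemma cfixed_inj (A B : cycsum) :
  (forall d, d <= nvertices B -> cfixed A d = cfixed B d) -> A = B.
Proof.
move=> H; apply/cycsumP; elim/ltn_ind => d IH.
have [d0|d0] := posnP d; first by rewrite d0 !ncycles0.
case: (leqP d (nvertices B)) => dB.
  have := H d dB; rewrite !cfixed_rec // (fixed_upto_eq _ IH) => /addnI.
  by move/eqP; rewrite eqn_pmul2l // => /eqP.
by rewrite !ncycles_big // nvertices_cfixed H // -nvertices_cfixed.
Qed.

Lemma solutionP A B X : solution A B X <->
  forall d, d <= nvertices B -> cfixed A d * cfixed X d = cfixed B d.
Proof.
split=> [<- d _|H]; first by rewrite cfixed_mul.
by apply: cfixed_inj => d /H; rewrite cfixed_mul.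
Qed.

Lemma nvertices_mul A X : nvertices (Defs.mul A X) = nvertices A * nvertices X.
Proof. by rewrite !nvertices_cfixed cfixed_mul. Qed.

Lemma nvertices_gt0 A : nonempty A -> 0 < nvertices A.
Proof.
case: A => A A0 /eqP nA; rewrite /= in A0 nA *.
have [E|[l lA]] := mset_0Vmem A; first by rewrite E eqxx in nA.
apply: leq_trans (leq_nvertices _ l); rewrite muln_gt0 /ncycles /=.
by rewrite -[0 < A l]in_mset lA andbT; case: l lA => //; rewrite in_mset (eqP A0).
Qed.

Lemma supp_mul (A X : cycsum) a b : 0 < A a -> 0 < X b ->
  lcmn a b \in supp (Defs.mul A X).
Proof.
move=> Aa Xb; rewrite /supp msuppE; apply/negPn/negP => N.
have pos (C : cycsum) l : 0 < C l -> 0 < l by case: l => //; rewrite ncycles0.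
have in_big (r : seq nat) (F : nat -> {mset nat}) x l : x \in r -> l \in F x ->
    l \in (\big[msetD/mset0]_(i <- r) F i)%mset.
  elim: r => // y r IH; rewrite inE big_cons in_msetD => /orP[/eqP <- -> //|xr lF].
  by rewrite IH ?orbT.
case/negP: N; apply: (in_big _ _ a); first by rewrite in_mset.
apply: (in_big _ _ b); first by rewrite in_mset.
by rewrite in_msetn eqxx gcdn_gt0 (pos _ _ Aa).
Qed.

Lemma prime_dvd_biglcm p (r : seq nat) : prime p ->
  p %| \big[lcmn/1]_(k <- r) k -> has (dvdn p) r.
Proof.
move=> pp; elim: r => [|k r IH].
  by rewrite big_nil dvdn1 => /eqP p1; rewrite p1 in pp.
rewrite big_cons /=; set m := \big[_/_]_(_ <- _) _ => pl.
have : p %| k * m by rewrite (dvdn_trans pl) // dvdn_lcm dvdn_mulr // dvdn_mull.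
by rewrite Euclid_dvdM // => /orP[->|/IH ->]; rewrite ?orbT.
Qed.

Lemma cfixed_le A d : cfixed A d <= nvertices A.
Proof.
rewrite nvertices_cfixed /cfixed /fixed big_mkcond [X in _ <= X]big_mkcond.
apply: leq_sum => l _; by rewrite dvdn0; case: ifP.
Qed.

Lemma fixed_upto_le n k F d : (forall l, l < k -> F l <= n) ->
  fixed_upto k F d <= k * (k * n).
Proof.
move=> H; rewrite /fixed_upto big_mkcond /= -[X in _ <= X * _]card_ord -sum_nat_const.
by apply: leq_sum => l _; case: ifP => // _; rewrite leq_mul ?H // ltnW.
Qed.

Lemma fixed_lists a A d : lists a A -> fixed a d = cfixed A d.
Proof. by move=> aA; rewrite /cfixed -aA fixed_seq_mset. Qed.

Lemma lists_gt0 a A l : lists a A -> l \in a -> 0 < l.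
Proof.
move=> aA la; case: l la => // H; have := ncycles0 A.
by rewrite /ncycles -aA mset_seqE => /eqP; rewrite -leqn0 leqNgt -has_count has_pred1 H.
Qed.

Lemma size_lists a A : lists a A -> size a <= nvertices A.
Proof.
move=> aA; rewrite nvertices_cfixed -(fixed_lists _ aA) /fixed.
under eq_bigl => l do rewrite dvdn0.
rewrite -sum1_size big_seq [X in _ <= X]big_seq; apply: leq_sum => l.
exact: lists_gt0 aA.
Qed.

(** * A solution is determined by its number of loops *)

Section PrimeInstance.
Variables A B : cycsum.
Hypothesis AB : basic_instance A B.
Hypothesis Ap : {in (supp A `\ 1)%fset, forall l, prime l}.

Lemma nvertices_solution X : solution A B X -> nvertices A * nvertices X = nvertices B.
Proof. by move=> <-; rewrite nvertices_mul. Qed.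

(** This is where the lengths of [A] being prime or [1] matters: one of them shares
    a prime factor with [d], and therefore divides [d]. *)
Lemma solution_cycle_dvd X d : solution A B X -> 0 < X d -> 1 < d ->
  0 < cfixed A d.
Proof.
move=> AX Xd d1; case: AB => nA _ AB'.
have [a Aa] : exists a, 0 < A a.
  case: (mset_0Vmem (lengths A)) => [/nA //|[a aA]].
  by exists a; rewrite /ncycles -in_mset.
have dP : d %| \big[lcmn/1]_(k <- supp A) k.
  apply: dvdn_trans (dvdn_lcmr a d) _; apply: AB'; rewrite -AX.
  exact: supp_mul.
have /hasP[l lA pl] := prime_dvd_biglcm (pdiv_prime d1) (dvdn_trans (pdiv_dvd d) dP).
have Al : 0 < A l by rewrite /ncycles -in_mset -msuppE.
have ld : l %| d.
  have [->|l1] := eqVneq l 1; first exact: dvd1n.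
  have lp : prime l by apply: Ap; rewrite !inE l1.
  by move: pl; rewrite dvdn_prime2 ?pdiv_prime // => /eqP <-; apply: pdiv_dvd.
have l0 : 0 < l by case: l Al {lA pl ld} => //; rewrite ncycles0.
rewrite cfixed_ltS ?(ltnW d1) // /fixed_upto.
have ld' : l < d.+1 by rewrite ltnS dvdn_leq // ltnW.
by rewrite (bigD1 (Ordinal ld')) //= addn_gt0 muln_gt0 l0 Al.
Qed.

(** The number of cycles of length [d] in a solution with [x] loops, computed from
    the numbers [X l] with [l < d]. Division by zero yields [0], which is the
    right value when no length in [A] divides [d]. *)
Definition next_count (x : nat) (X : nat -> nat) (d : nat) : nat :=
  (d == 1) * x +
  (2 <= d) * ((cfixed B d %/ cfixed A d - fixed_upto d X d) %/ d).

Lemma solution_next X d : solution A B X -> X d = next_count (X 1) X d.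
Proof.
move=> AX; rewrite /next_count.
case: d => [|[|d]] /=; first by rewrite ncycles0.
  by rewrite mul1n addn0.
rewrite mul0n mul1n add0n -AX cfixed_mul.
have [A0|A0] := posnP (cfixed A d.+2); last first.
  by rewrite mulKn // cfixed_rec // addKn mulKn.
rewrite A0 mul0n div0n sub0n div0n; apply/eqP; rewrite -leqn0 leqNgt.
by apply/negP => /(solution_cycle_dvd AX) /(_ isT); rewrite A0.
Qed.

Lemma solution_unique X n (F : nat -> nat) : solution A B X ->
  (forall d, d < n -> F d = next_count (X 1) F d) -> forall d, d < n -> F d = X d.
Proof.
move=> AX HF; elim/ltn_ind => d IH dn; rewrite HF // [RHS]solution_next //.
congr (_ + _ * ((_ - _) %/ _)); apply: fixed_upto_eq => l ld.
by apply: IH => //; apply: ltn_trans dn.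
Qed.

Lemma solution_inj X Y : solution A B X -> solution A B Y -> X 1 = Y 1 -> X = Y.
Proof.
move=> AX AY E; apply/cycsumP => d.
apply: (@solution_unique _ d.+1) => // l _; rewrite -E; exact: solution_next.
Qed.

End PrimeInstance.

(** * Lists of cycles and the number of solutions *)

Definition cycles (m : nat) (F : nat -> nat) : seq nat :=
  flatten [seq nseq (F l) l | l <- iota 1 m].

Lemma count_cycles m F l : count_mem l (cycles m F) = if 0 < l <= m then F l else 0.
Proof.
rewrite /cycles; elim: m => [|m IH]; first by case: l.
rewrite -{1}(addn1 m) iotaD map_cat flatten_cat count_cat IH /= cats0.
rewrite count_nseq /= add1n.
case: (ltngtP l m.+1) => H; rewrite /= ?mul0n ?addn0.
- by move: H; rewrite ltnS => ->.
- by rewrite (leqNgt l m) (ltnW H) !andbF.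
- by rewrite H ltnn mul1n.
Qed.

Fact cycles0 m F : seq_mset (cycles m F) 0 == 0.
Proof. by rewrite mset_seqE count_cycles. Qed.

Definition cycsum_of (m : nat) (F : nat -> nat) : cycsum := CycSum (cycles0 m F).

Lemma cycsum_ofE m F l : cycsum_of m F l = if 0 < l <= m then F l else 0.
Proof. by rewrite /ncycles /= mset_seqE count_cycles. Qed.

Lemma cycsum_of_id m (X : cycsum) F : nvertices X <= m ->
  (forall l, l <= m -> F l = X l) -> cycsum_of m F = X.
Proof.
move=> Xm FX; apply/cycsumP => l; rewrite cycsum_ofE.
case: (posnP l) => [->|l0] /=; first by rewrite ncycles0.
by case: leqP => lm; [rewrite FX | rewrite ncycles_big // (leq_ltn_trans Xm)].
Qed.

Lemma cfixed_cycsum_of m F d : F 0 = 0 ->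
  cfixed (cycsum_of m F) d = fixed_upto m.+1 F d.
Proof.
move=> F0; rewrite (@cfixed_upto _ _ m.+1).
  apply: fixed_upto_eq => l lm; rewrite cycsum_ofE.
  by move: lm; rewrite ltnS => ->; case: l.
by move=> l; rewrite cycsum_ofE ltnS; case: (leqP l m) => // _; rewrite andbF.
Qed.

Lemma size_cycles m F : F 0 = 0 -> size (cycles m F) <= fixed_upto m.+1 F 0.
Proof.
move=> F0; rewrite -cfixed_cycsum_of // -nvertices_cfixed.
exact: size_lists.
Qed.

(** If all vertices but one carried loops, the last one would be alone on a cycle
    of length greater than [1]. *)
Lemma loops_neq_pred_nvertices (X : cycsum) :
  0 < nvertices X -> X 1 <> (nvertices X).-1.
Proof.
move=> X0 X1.
have : nvertices X = X 1 + \sum_(2 <= l < (nvertices X).+1) l * X l.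
  transitivity (\sum_(0 <= l < (nvertices X).+1) l * X l).
    rewrite [LHS]nvertices_cfixed (cfixed_nvertices _ (ltnSn _)) big_mkord.
    by apply: eq_bigl => l; rewrite dvdn0.
  by rewrite big_ltn // big_ltn ?ltnS // mul0n mul1n.
case: (posnP (\sum_(2 <= l < (nvertices X).+1) l * X l)) => [->|S0]; first by lia.
suff : 2 <= \sum_(2 <= l < (nvertices X).+1) l * X l by lia.
move: S0; rewrite !big_nat.
elim/big_ind: _ => // [x y Hx Hy|l /andP[l2 _]]; first by rewrite addn_gt0; lia.
by rewrite muln_gt0 => /andP[_ Xl]; rewrite (leq_trans l2) // leq_pmulr.
Qed.

Section Instance.
Variables A B : cycsum.
Hypothesis AB : basic_instance A B.
Hypothesis Ap : {in (supp A `\ 1)%fset, forall l, prime l}.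
Local Notation n := (nvertices B).

Lemma nvertices_gt0A : 0 < nvertices A.
Proof. by case: AB => /nvertices_gt0. Qed.

Lemma nvertices_gt0B : 0 < n.
Proof. by case: AB => _ /nvertices_gt0. Qed.

Lemma solution_nvertices X : solution A B X -> nvertices X <= n.
Proof.
move=> /nvertices_solution <-; exact: leq_pmull nvertices_gt0A.
Qed.

(** The counts of a solution are bounded by [|B|], so there are finitely many
    candidates. *)
Lemma solutions_finite : exists S, solution_set A B S.
Proof.
pose Y (F : {ffun 'I_n.+1 -> 'I_n.+1}) := cycsum_of n (fun l => F (inord l)).
exists [fset X in [seq Y F | F <- enum {ffun 'I_n.+1 -> 'I_n.+1}]
             | Defs.mul A X == B]%fset.
move=> X; rewrite !inE; split=> [/andP[_ /eqP] //|AX].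
apply/andP; split; last exact/eqP.
apply/mapP; exists [ffun l : 'I_n.+1 => inord (X l)]; first by rewrite mem_enum.
have Xn := solution_nvertices AX.
symmetry; apply: cycsum_of_id => // l ln; rewrite ffunE !inordK //.
rewrite ltnS; case: l ln => [|l ln]; first by rewrite ncycles0.
by apply: leq_trans Xn; apply: leq_trans (leq_nvertices X l.+1); apply: leq_pmull.
Qed.

(** The number of loops maps the solutions injectively into the [n] numbers left in
    [0, ..., n] without [n - 1], where [n = |B| / |A|]. *)
Lemma solutions_bound S : solution_set A B S ->
  ((#|` S|)%:R <= n%:R / (nvertices A)%:R :> rat)%R.
Proof.
move=> HS.
have A0 : (0 < (nvertices A)%:R :> rat)%R by rewrite Num.Theory.ltr0n nvertices_gt0A.
rewrite Num.Theory.ler_pdivlMr // -GRing.natrM Num.Theory.ler_nat.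
have [->|[X0 X0S]] := fset_0Vmem S; first by rewrite cardfs0.
have /HS AX0 := X0S; rewrite -(nvertices_solution AX0) mulnC leq_mul2l.
apply/orP; right; set m := nvertices X0.
have nX X : X \in S -> nvertices X = m.
  move=> /HS AX; apply/eqP; rewrite -(eqn_pmul2l nvertices_gt0A).
  by rewrite (nvertices_solution AX) (nvertices_solution AX0).
have m0 : 0 < m.
  by have := nvertices_gt0B; rewrite -(nvertices_solution AX0) muln_gt0 => /andP[].
have mE : m = size (rem m.-1 (iota 0 m.+1)).
  by rewrite size_rem ?size_iota // mem_iota; lia.
rewrite mE cardfE cardE -(size_map (fun X : S => (val X) 1)).
apply: uniq_leq_size.
  rewrite map_inj_uniq ?enum_uniq // => X Y E; apply: val_inj.
  by apply: (solution_inj AB Ap) E; apply/HS; apply: valP.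
move=> _ /mapP[X _ ->]; rewrite (rem_filter _ (iota_uniq _ _)) mem_filter mem_iota /=.
have := nX _ (valP X) => E.
have := @loops_neq_pred_nvertices (val X); rewrite E => /(_ m0) /eqP -> /=.
rewrite add0n ltnS -E.
by have := leq_nvertices (val X) 1; rewrite mul1n.
Qed.
End Instance.

(** * A program logic for total correctness with time bounds

    An execution of the machine gets stuck when a value exceeds the word bound.
    This is excluded uniformly: as long as all cells and literals are at most
    [M], an expression with [k] leaves and all its subexpressions have values at
    most [M ^ k]. It then suffices to keep the cells below [M], and to run the
    machine with word bound [M ^ 10]. *)

(** The value of an expression in the absence of overflow. *)
Fixpoint value (s : memory) (e : expr) : nat :=
  match e with
  | Lit n => n
  | Get a e1 => s a (value s e1)
  | Op o e1 e2 => binop_sem o (value s e1) (value s e2)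
  end.

Fixpoint leaves (e : expr) : nat :=
  match e with
  | Lit _ => 1
  | Get _ e1 => leaves e1
  | Op _ e1 e2 => leaves e1 + leaves e2
  end.

Fixpoint small_literals (e : expr) : bool :=
  match e with
  | Lit n => n <= 2
  | Get _ e1 => small_literals e1
  | Op _ e1 e2 => small_literals e1 && small_literals e2
  end.

Definition bounded (M : nat) (s : memory) : Prop := forall a i, s a i <= M.

Definition safe (e : expr) : bool := small_literals e && (leaves e <= 10).

Section Logic.
Variable M : nat.
Hypothesis M2 : 2 <= M.

Lemma leaves_gt0 e : 0 < leaves e.
Proof. by elim: e => //= o e1 ? e2 ?; rewrite addn_gt0; apply/orP; left. Qed.

(** A sum of two numbers greater than [1] is at most their product, so all the
    operations are bounded by multiplication. *)
Lemma value_bound s e : bounded M s -> small_literals e -> value s e <= M ^ leaves e.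
Proof.
move=> sM; have pow k : 0 < k -> M <= M ^ k.
  by move=> k0; rewrite -{1}[M]expn1 leq_pexp2l // ltnW.
elim: e => [n|a e1 _|o e1 IH1 e2 IH2] /=.
- by move=> n2; rewrite expn1 (leq_trans n2).
- by move=> _; apply: leq_trans (sM _ _) _; rewrite pow // leaves_gt0.
case/andP => /IH1 {IH1} H1 /IH2 {IH2} H2; rewrite expnD.
have := leq_trans M2 (pow _ (leaves_gt0 e1)).
have := leq_trans M2 (pow _ (leaves_gt0 e2)).
move: (M ^ _) (M ^ _) (value s e1) (value s e2) H1 H2 => p2 p1 v1 v2 H1 H2 h2 h1.
have h : p1 <= p1 * p2 by apply: leq_pmulr; apply: ltnW.
have h' : p1 + p2 <= p1 * p2 by nia.
have B (b : bool) : b <= p1 * p2 by case: b; nia.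
case: o => //=.
- by apply: leq_trans h'; apply: leq_add.
- by apply: leq_trans h; apply: leq_trans (leq_subr _ _) H1.
- exact: leq_mul.
- by apply: leq_trans h; apply: leq_trans (leq_div _ _) H1.
- by apply: leq_trans h; apply: leq_trans (leq_mod _ _) H1.
Qed.

Lemma eval_value s e : bounded M s -> safe e ->
  eval (M ^ 10) s e = Some (value s e).
Proof.
move=> sM /andP[].
have wordS k n : n <= M ^ k -> k <= 10 -> word (M ^ 10) n = Some n.
  by move=> nk kK; rewrite /word (leq_trans nk) // leq_pexp2l // ltnW.
have vb := value_bound sM.
elim: e => [n|a e1 IH|o e1 IH1 e2 IH2] /=.
- by move=> n2 K; rewrite (@wordS 1) // expn1 (leq_trans n2).
- by move=> e1l K; rewrite IH //= (@wordS 1) // expn1.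
case/andP => l1 l2 K.
rewrite IH1 ?IH2 //; [|by move: K; lia ..].
by rewrite /= (@wordS (leaves e1 + leaves e2)) // (vb (Op o e1 e2)) //= l1.
Qed.

(** From the memory [s], the program [P] halts within [t] steps in a memory which
    satisfies [Q] and whose cells are still at most [M]. *)
Definition runs (P : prog) (s : memory) (t : nat) (Q : memory -> Prop) : Prop :=
  exists u s', [/\ exec (M ^ 10) P s u s', u <= t, bounded M s' & Q s'].

Lemma runs_weaken P s t t' (Q Q' : memory -> Prop) :
  runs P s t Q -> t <= t' -> (forall s', bounded M s' -> Q s' -> Q' s') ->
  runs P s t' Q'.
Proof.
move=> [u [s' [ex ut sM Qs]]] tt QQ; exists u, s'; split=> //.
  exact: leq_trans tt.
exact: QQ.
Qed.

Lemma runs_skip s t (Q : memory -> Prop) :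
  bounded M s -> 0 < t -> Q s -> runs Skip s t Q.
Proof. by move=> sM t0 Qs; exists 1, s; split=> //; apply: ExecSkip. Qed.

Lemma runs_set a ei ev s t (Q : memory -> Prop) :
  bounded M s -> safe ei -> safe ev -> cost ei + cost ev < t ->
  value s ev <= M -> Q (update s a (value s ei) (value s ev)) ->
  runs (Set_ a ei ev) s t Q.
Proof.
move=> sM fi fv ct vM Qs; exists (cost ei + cost ev).+1; eexists; split; last exact: Qs.
- by apply: ExecSet; apply: eval_value.
- by [].
by move=> a' i'; rewrite /update; case: ifP.
Qed.

Lemma runs_seq P1 P2 s t1 t2 (Q R : memory -> Prop) :
  runs P1 s t1 Q ->
  (forall s', bounded M s' -> Q s' -> runs P2 s' t2 R) ->
  runs (Seq P1 P2) s (t1 + t2) R.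
Proof.
move=> [u [s' [ex ut sM Qs]]] /(_ _ sM Qs) [v [s'' [ex' vt sM' Rs]]].
exists (u + v), s''; split=> //; last exact: leq_add.
exact: ExecSeq ex ex'.
Qed.

Lemma runs_if e P1 P2 s t (Q : memory -> Prop) :
  bounded M s -> safe e ->
  (value s e != 0 -> runs P1 s t Q) -> (value s e = 0 -> runs P2 s t Q) ->
  runs (If e P1 P2) s (cost e + t).+1 Q.
Proof.
move=> sM fe H1 H2; have := eval_value sM fe.
case E: (value s e) H1 H2 => [|n] H1 H2 ev.
  have [u [s' [ex ut sM' Qs]]] := H2 erefl.
  exists (cost e + u).+1, s'; split=> //; first exact: ExecIfFalse.
  by rewrite ltnS leq_add2l.
have [u [s' [ex ut sM' Qs]]] := H1 isT.
exists (cost e + u).+1, s'; split=> //; first exact: ExecIfTrue ev ex.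
by rewrite ltnS leq_add2l.
Qed.

(** The scalar variable [v] is the cell [0] of the array [v]. *)
Definition Var (v : nat) : expr := Get v (Lit 0).
Definition Assign (v : nat) (e : expr) : prog := Set_ v (Lit 0) e.
Definition Incr (v : nat) : prog := Assign v (Op Add (Var v) (Lit 1)).
Definition For (v : nat) (e : expr) (P : prog) : prog :=
  Seq (Assign v (Lit 0)) (While (Op Defs.Sub e (Var v)) (Seq P (Incr v))).

(** The invariant [I k] is required of the memory at the beginning of the round [k],
    when the loop variable has the value [k]; the value [n] of the upper bound [e]
    may not change during the loop. *)
Lemma runs_for v e P n t (I : nat -> memory -> Prop) s :
  bounded M s -> safe (Op Defs.Sub e (Var v)) -> n <= M ->
  I 0 (update s v 0 0) ->
  (forall k s', k <= n -> bounded M s' -> s' v 0 = k -> I k s' -> value s' e = n) ->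
  (forall k s', k < n -> bounded M s' -> s' v 0 = k -> I k s' ->
     runs P s' t (fun s'' => s'' v 0 = k /\ I k.+1 (update s'' v 0 k.+1))) ->
  runs (For v e P) s (n.+1 * (t + cost e + 16)) (fun s' => s' v 0 = n /\ I n s').
Proof.
move=> sM fe nM I0 Ie IP.
have step : forall m k s', k + m = n -> bounded M s' -> s' v 0 = k -> I k s' ->
    runs (While (Op Defs.Sub e (Var v)) (Seq P (Incr v))) s'
      (m.+1 * (t + cost e + 13)) (fun s' => s' v 0 = n /\ I n s').
  elim=> [|m IH] k s' km s'M s'v Ik.
    have E : eval (M ^ 10) s' (Op Defs.Sub e (Var v)) = Some 0.
      rewrite eval_value //=; congr Some.
      by rewrite (Ie k) ?s'v //; lia.
    exists (cost (Op Defs.Sub e (Var v))).+1, s'; split=> //.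
    - exact: ExecWhileFalse.
    - by rewrite /=; lia.
    by rewrite s'v; move: km Ik; rewrite addn0 => ->.
  have kn : k < n by lia.
  have E : eval (M ^ 10) s' (Op Defs.Sub e (Var v)) = Some m.+1.
    rewrite eval_value //=; congr Some.
    by rewrite (Ie k) ?s'v //; lia.
  have [] := @runs_seq P (Incr v) s' t 6 _ (fun s'' => s'' v 0 = k.+1 /\ I k.+1 s'')
    (IP _ _ kn s'M s'v Ik).
    move=> s1 s1M [s1v Ik1]; apply: runs_set => //=; rewrite s1v addn1.
      exact: leq_trans nM.
    by split=> //; rewrite /update !eqxx.
  move=> u [s1 [ex ut s1M [s1v Ik1]]].
  have [|u' [s2 [ex' ut' s2M Qs]]] := IH k.+1 s1 _ s1M s1v Ik1; first by lia.
  exists (cost (Op Defs.Sub e (Var v)) + u + u').+1, s2; split=> //.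
    exact: ExecWhileTrue E ex ex'.
  by move: ut ut' => /=; nia.
apply: runs_weaken.
- apply: (@runs_seq _ _ _ 3 (n.+1 * (t + cost e + 13))
    (fun s' => s' v 0 = 0 /\ I 0 s')).
    by apply: runs_set => //; split=> //=; rewrite /update !eqxx.
  by move=> s' s'M [s'v I0']; apply: (step n 0).
- by rewrite /=; nia.
by [].
Qed.
End Logic.

(** * The program *)

(** The arrays of the program. The lists of cycles of [A] and [B] are in [v_A] and
    [v_B], the solutions are written to [v_out], and [v_cnt] holds the numbers of
    cycles of the current candidate by length. The others are scalars: the loop
    variables [v_idx], [v_len], [v_x] and [v_rep], the results [v_fixA],
    [v_fixB], [v_sum] and [v_nB] of sums, the outcome [v_ok] of the test, and the
    first free position [v_top] of [v_out]. *)
Local Notation v_A := 0 (only parsing).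
Local Notation v_B := 1 (only parsing).
Local Notation v_out := 2 (only parsing).
Local Notation v_cnt := 3 (only parsing).
Local Notation v_idx := 4 (only parsing).
Local Notation v_len := 5 (only parsing).
Local Notation v_fixA := 6 (only parsing).
Local Notation v_fixB := 7 (only parsing).
Local Notation v_sum := 8 (only parsing).
Local Notation v_nB := 9 (only parsing).
Local Notation v_x := 10 (only parsing).
Local Notation v_ok := 11 (only parsing).
Local Notation v_top := 12 (only parsing).
Local Notation v_rep := 13 (only parsing).

(** The frame condition: only the arrays in [L] have changed. *)
Definition same (L : seq nat) (s s' : memory) : Prop :=
  forall a, a \notin L -> forall i, s' a i = s a i.

Lemma same_update L s s' a i v : a \in L -> same L s s' ->
  same L s (update s' a i v).
Proof.
move=> aL S a' a'L i'; rewrite -S // /update.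
by case: eqP => // E; rewrite -E (negbTE a'L) in aL.
Qed.

Lemma same_trans L L' s1 s2 s3 : all (mem L) L' ->
  same L s1 s2 -> same L' s2 s3 -> same L s1 s3.
Proof.
move=> /allP LL S1 S2 a aL i; rewrite S2 ?S1 //.
by apply: contra aL; apply: LL.
Qed.

Definition Sum (acc : nat) (bnd e : expr) : prog :=
  Seq (Assign acc (Lit 0)) (For v_idx bnd (Assign acc (Op Add (Var acc) e))).

Definition term (arr : nat) : expr := Get arr (Op Add (Var v_idx) (Lit 1)).
Definition divides (e1 e2 : expr) : expr := Op Eq (Op Mod e2 e1) (Lit 0).

(** Computes [fixed c d], where the array [arr] encodes the list [c] and [d] is the
    value of [v_len]. *)
Definition SumFixed (arr acc : nat) : prog :=
  Sum acc (Get arr (Lit 0)) (Op Mul (term arr) (divides (term arr) (Var v_len))).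

(** Computes [fixed_upto m X d], where [m] is the value of [bnd], [X] the content of
    [v_cnt] and [d] the value of [v_len]. *)
Definition SumFixedCounts (bnd : expr) : prog :=
  Sum v_sum bnd (Op Mul (Op Mul (Var v_idx) (Get v_cnt (Var v_idx)))
                        (divides (Var v_idx) (Var v_len))).

(** Both programs below need these three sums for each length, and use them in the
    last command of the loop. *)
Definition SumsThen (bnd : expr) (P : prog) : prog :=
  Seq (SumFixed v_A v_fixA) (Seq (SumFixed v_B v_fixB)
    (Seq (SumFixedCounts bnd) P)).

Definition bound : expr := Op Add (Var v_nB) (Lit 1).

Definition next_count_expr : expr :=
  Op Add (Op Mul (Op Eq (Var v_len) (Lit 1)) (Var v_x))
    (Op Mul (Op Le (Lit 2) (Var v_len))
       (Op Div (Op Defs.Sub (Op Div (Var v_fixB) (Var v_fixA)) (Var v_sum))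
          (Var v_len))).

Definition Candidate : prog :=
  For v_len bound
    (SumsThen (Var v_len) (Set_ v_cnt (Var v_len) next_count_expr)).

Definition check_expr : expr :=
  Op Mul (Var v_ok) (Op Eq (Op Mul (Var v_fixA) (Var v_sum)) (Var v_fixB)).

Definition Check : prog :=
  Seq (Assign v_ok (Lit 1))
    (For v_len bound (SumsThen bound (Assign v_ok check_expr))).

Definition Emit (e : expr) : prog :=
  Seq (Set_ v_out (Var v_top) e) (Incr v_top).

Definition Output : prog :=
  Seq (Sum v_sum bound (Get v_cnt (Var v_idx))) (Seq (Emit (Var v_sum))
    (Seq (For v_len bound (For v_rep (Get v_cnt (Var v_len)) (Emit (Var v_len))))
      (Set_ v_out (Lit 0) (Op Add (Get v_out (Lit 0)) (Lit 1))))).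

Definition Round : prog := Seq Candidate (Seq Check (If (Var v_ok) Output Skip)).

(** The first sum is [|B|], because every length divides the initial value [0] of
    [v_len]. A solution exists only if [A] has at most [|B|] cycles; the test keeps
    the time independent of [|A|]. *)
Definition solver : prog :=
  Seq (SumFixed v_B v_nB) (If (Op Le (Get v_A (Lit 0)) (Var v_nB))
    (Seq (Assign v_top (Lit 1)) (For v_x bound Round))
    Skip).

(** * Correctness of the sums *)

Section Macros.
Variable M : nat.
Hypothesis M2 : 2 <= M.

Lemma runs_sum acc bnd e n F s :
  v_idx != acc -> bounded M s ->
  safe (Op Defs.Sub bnd (Var v_idx)) -> safe (Op Add (Var acc) e) ->
  (forall k s', same [:: v_idx; acc] s s' -> s' v_idx 0 = k ->
     value s' bnd = n /\ (k < n -> value s' e = F k)) ->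
  n <= M -> \sum_(k < n) F k <= M ->
  runs M (Sum acc bnd e) s (n.+1 * (cost e + cost bnd + 30))
    (fun s' => s' acc 0 = \sum_(k < n) F k /\ same [:: v_idx; acc] s s').
Proof.
move=> acc4 sM sb se H nM FM.
have acc4' : (acc == v_idx) = false by rewrite eq_sym; apply/negbTE.
pose I k s' := s' acc 0 = \sum_(j < k) F j /\ same [:: v_idx; acc] s s'.
apply: (@runs_weaken _ _ _ (3 + n.+1 * (cost e + 10 + cost bnd + 16)) _
  (fun s' => s' v_idx 0 = n /\ I n s')); last 2 first.
- by nia.
- by move=> s' _ [].
apply: (@runs_seq _ _ _ _ _ _ (I 0)).
  apply: runs_set => //; split; first by rewrite /update !eqxx big_ord0.
  by apply: same_update => //; rewrite !inE eqxx orbT.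
move=> s1 s1M [s1a s1s]; apply: (runs_for M2 (I := I)) => //.
- split; last by apply: same_update; rewrite ?inE.
  by rewrite /update acc4'.
- by move=> k s' kn s'M s'4 [_ /H] /(_ _ s'4) [].
move=> k s' kn s'M s'4 [s'a s's].
have E : value s' (Op Add (Var acc) e) = \sum_(j < k.+1) F j.
  by rewrite /= s'a big_ord_recr; have [_ ->] := H _ _ s's s'4.
apply: runs_set => //=; first by lia.
- rewrite -[X in X <= M]/(value s' (Op Add (Var acc) e)) E (leq_trans _ FM) //.
  rewrite -(subnKC kn) big_split_ord /=.
  by apply: leq_trans (leq_addr _ _); apply: eq_leq; apply: eq_bigr.
rewrite -[X in update s' acc 0 X]/(value s' (Op Add (Var acc) e)) E.
split; first by rewrite /update (negbTE acc4) /=.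
split; first by rewrite /update acc4' !eqxx.
by do 2! [apply: same_update; first by rewrite !inE eqxx ?orbT].
Qed.

Lemma runs_fixed arr acc c s :
  arr \notin [:: v_idx; acc] -> acc \notin [:: v_idx; v_len] -> bounded M s ->
  (forall i, s arr i = nth 0 (encode c) i) -> fixed c (s v_len 0) <= M ->
  runs M (SumFixed arr acc) s ((size c).+1 * 60)
    (fun s' => s' acc 0 = fixed c (s v_len 0) /\ same [:: v_idx; acc] s s').
Proof.
rewrite !inE !negb_or => /andP[r4 ra] /andP[a4 a5] sM sc cM.
have E : fixed c (s v_len 0) = \sum_(k < size c) nth 0 c k * (nth 0 c k %| s v_len 0).
  rewrite /fixed big_mkcond (big_nth 0) big_mkord; apply: eq_bigr => k _.
  by case: (_ %| _); rewrite ?muln1 ?muln0.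
rewrite E in cM *.
apply: (@runs_weaken _ _ _ _ _ _ _ (runs_sum (n := size c)
  (F := fun k => nth 0 c k * (nth 0 c k %| s v_len 0)) _ sM _ _ _ _ _)) => //.
- by rewrite eq_sym.
- move=> k s' S s'4; have Sr i : s' arr i = nth 0 (encode c) i.
    by rewrite S ?sc // !inE !negb_or r4.
  rewrite /= !Sr s'4 addn1 /=; split=> // _.
  by rewrite (S v_len) // !inE /= eq_sym.
- by have := sM arr 0; rewrite sc.
by rewrite leq_pmul2l.
Qed.

Lemma runs_fixed_counts bnd n s :
  safe (Op Defs.Sub bnd (Var v_idx)) -> cost bnd <= 4 -> bounded M s ->
  (forall s', same [:: v_idx; v_sum] s s' -> value s' bnd = n) ->
  n <= M -> fixed_upto n (s v_cnt) (s v_len 0) <= M ->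
  runs M (SumFixedCounts bnd) s (n.+1 * 60)
    (fun s' => s' v_sum 0 = fixed_upto n (s v_cnt) (s v_len 0) /\
       same [:: v_idx; v_sum] s s').
Proof.
move=> sb cb sM Hb nM.
have -> : fixed_upto n (s v_cnt) (s v_len 0) =
    \sum_(k < n) k * s v_cnt k * (k %| s v_len 0).
  rewrite /fixed_upto big_mkcond; apply: eq_bigr => k _.
  by case: (_ %| _); rewrite ?muln1 ?muln0.
move=> FM; apply: (@runs_weaken _ _ _ _ _ _ _ (runs_sum (n := n)
  (F := fun k => k * s v_cnt k * (k %| s v_len 0)) _ sM _ _ _ _ _)) => //.
- move=> k s' S s'4; split; first exact: Hb.
  by rewrite /= s'4 !S.
- by rewrite leq_pmul2l //=; lia.
Qed.
End Macros.

(** * Correctness of the parts of the program *)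

Section Phases.
Variables (A B : cycsum) (a b : seq nat) (M : nat).
Hypotheses (aA : lists a A) (bB : lists b B).
Local Notation n := (nvertices B).
Hypotheses (A0 : 0 < nvertices A) (B0 : 0 < n).
Hypotheses (AM : nvertices A <= M) (BM : n.+1 * (n.+1 * n.+1) <= M).

Let M2 : 2 <= M. Proof. nia. Qed.
Let nM : n.+1 <= M. Proof. nia. Qed.

Definition loaded (s : memory) : Prop :=
  [/\ forall i, s v_A i = nth 0 (encode a) i, forall i, s v_B i = nth 0 (encode b) i
    & s v_nB 0 = n].

Lemma loaded_same L s s' : [&& v_A \notin L, v_B \notin L & v_nB \notin L] ->
  same L s s' -> loaded s -> loaded s'.
Proof.
case/and3P => L0 L1 L9 S [s0 s1 s9]; split=> [i|i|]; by rewrite S.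
Qed.

Lemma loaded_bound s : loaded s -> value s bound = n.+1.
Proof. by case=> _ _ /= ->; rewrite addn1. Qed.

Lemma next_count_le x X d : x <= n -> next_count A B x X d <= n.
Proof.
move=> xn; rewrite /next_count; case: eqP => [->|_]; first by rewrite mul1n addn0.
rewrite mul0n add0n; case: (2 <= d); last by rewrite mul0n.
rewrite mul1n (leq_trans (leq_div _ _)) // (leq_trans (leq_subr _ _)) //.
by rewrite (leq_trans (leq_div _ _)) // cfixed_le.
Qed.

Hypothesis size_a : size a <= n.

(** The constants in the time bounds are generous: they only have to absorb the
    cost of the expressions. *)
Lemma runs_sums bnd m s d P t Q :
  bounded M s -> loaded s -> s v_len 0 = d ->
  safe (Op Defs.Sub bnd (Var v_idx)) -> cost bnd <= 4 -> m <= n.+1 ->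
  (forall s', same [:: v_idx; v_fixA; v_fixB; v_sum] s s' -> value s' bnd = m) ->
  (forall l, l < m -> s v_cnt l <= n) ->
  (forall s', bounded M s' -> same [:: v_idx; v_fixA; v_fixB; v_sum] s s' ->
     s' v_fixA 0 = cfixed A d -> s' v_fixB 0 = cfixed B d ->
     s' v_sum 0 = fixed_upto m (s v_cnt) d -> runs M P s' t Q) ->
  runs M (SumsThen bnd P) s (180 * n.+2 + t) Q.
Proof.
move=> sM [sA sB _] sd sb cb mn Hb Hcnt HP.
have size_b := size_lists bB.
apply: (@runs_weaken _ _ _
  ((size a).+1 * 60 + ((size b).+1 * 60 + (m.+1 * 60 + t))) _ Q Q) => //; last by lia.
apply: runs_seq.
  apply: (runs_fixed M2 (c := a)) => //.
  by rewrite (fixed_lists _ aA) (leq_trans (cfixed_le _ _)).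
move=> s1 s1M [s1a S1]; apply: runs_seq.
  apply: (runs_fixed M2 (c := b)) => // [i|]; first by rewrite S1.
  by rewrite (fixed_lists _ bB) (leq_trans (cfixed_le _ _)) // ltnW.
move=> s2 s2M [s2b S2].
have S02 : same [:: v_idx; v_fixA; v_fixB] s s2.
  by apply: same_trans S2; last apply: (same_trans _ _ S1).
have E2 : fixed_upto m (s2 v_cnt) (s2 v_len 0) = fixed_upto m (s v_cnt) d.
  by rewrite S02 // sd; apply: fixed_upto_eq => l _; apply: S02.
apply: runs_seq.
  apply: (runs_fixed_counts M2 (n := m)) => //.
  - move=> s' S; apply: Hb; apply: (same_trans (L' := [:: v_idx; v_sum])) S => //.
    by apply: same_trans S02.
  - exact: leq_trans nM.
  rewrite E2; apply: leq_trans (fixed_upto_le (n := n) _ Hcnt) _.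
  by apply: leq_trans BM; rewrite !leq_mul.
move=> s3 s3M [s3x S3]; apply: HP => //.
- by apply: same_trans S3; last apply: (same_trans _ _ S02).
- by rewrite S3 // S2 // s1a sd (fixed_lists _ aA).
- by rewrite S3 // s2b S1 // sd (fixed_lists _ bB).
by rewrite s3x E2.
Qed.

Lemma runs_candidate s x : bounded M s -> loaded s -> s v_x 0 = x -> x <= n ->
  runs M Candidate s (600 * (n.+1 * n.+1))
    (fun s' => same [:: v_cnt; v_idx; v_len; v_fixA; v_fixB; v_sum] s s' /\
       forall d, d < n.+1 -> s' v_cnt d = next_count A B x (s' v_cnt) d).
Proof.
move=> sM sl sx xn.
pose I k s' := same [:: v_cnt; v_idx; v_len; v_fixA; v_fixB; v_sum] s s' /\
  forall d, d < k -> s' v_cnt d = next_count A B x (s' v_cnt) d.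
apply: (@runs_weaken _ _ _ (n.+2 * (180 * n.+2 + 40 + 4 + 16)) _
  (fun s' => s' v_len 0 = n.+1 /\ I n.+1 s')); last 2 first.
- have := leq_pmulr n B0; move: (n) B0 => m m0 mm; lia.
- by move=> s' _ [].
apply: (runs_for M2 (I := I)) => //.
- by split=> //; apply: same_update.
- by move=> k s' _ _ _ [/loaded_same/(_ sl) - /(_ isT) /loaded_bound].
move=> k s0 kn s0M s0k [S0 H0].
have L0 : loaded s0 by apply: loaded_same S0 sl.
apply: (runs_sums (m := k) s0M L0 s0k) => //; first exact: ltnW.
- by move=> s' S; rewrite /= S.
- by move=> l lk; rewrite H0 // next_count_le.
move=> s1 s1M S1 s1A s1B s1s.
have s1k : s1 v_len 0 = k by rewrite S1.
have V : value s1 next_count_expr = next_count A B x (s0 v_cnt) k.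
  by rewrite /= s1k s1A s1B s1s S1 // S0 // sx.
apply: runs_set => //.
  by rewrite V (leq_trans (next_count_le _ _ xn)) // ltnW.
rewrite V [value s1 (Var v_len)]/= s1k; split; first by rewrite /update /=.
split.
  do 2! [apply: same_update; first by []].
  by apply: same_trans S1.
(* The recurrence for [d] only reads cells below [d], so it survives writing to
   the cell [k >= d]. *)
move=> d; rewrite ltnS => dk; rewrite /update /=.
have -> : next_count A B x
    (fun i => if i == k then next_count A B x (s0 v_cnt) k else s1 v_cnt i) d
   = next_count A B x (s0 v_cnt) d.
  congr (_ + _ * ((_ - _) %/ _)); apply: fixed_upto_eq => l ld.
  by rewrite ltn_eqF ?S1 // (leq_trans ld).
case: eqP => [-> //|/eqP ne].
by rewrite S1 // H0 // ltn_neqAle ne.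
Qed.

Definition passes (X : nat -> nat) : bool :=
  all (fun d => cfixed A d * fixed_upto n.+1 X d == cfixed B d) (iota 0 n.+1).

Lemma runs_check s : bounded M s -> loaded s ->
  (forall l, l < n.+1 -> s v_cnt l <= n) ->
  runs M Check s (600 * (n.+1 * n.+1))
    (fun s' => same [:: v_idx; v_len; v_fixA; v_fixB; v_sum; v_ok] s s' /\
       s' v_ok 0 = passes (s v_cnt)).
Proof.
move=> sM sl sn.
pose ok k :=
  all (fun d => cfixed A d * fixed_upto n.+1 (s v_cnt) d == cfixed B d) (iota 0 k).
pose I k s' := same [:: v_idx; v_len; v_fixA; v_fixB; v_sum; v_ok] s s' /\
  s' v_ok 0 = ok k.
apply: (@runs_weaken _ _ _ (3 + n.+2 * (180 * n.+2 + 40 + 4 + 16)) _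
  (fun s' => s' v_len 0 = n.+1 /\ I n.+1 s')); last 2 first.
- have := leq_pmulr n B0; move: (n) B0 => m m0 mm; lia.
- by move=> s' _ [].
apply: (@runs_seq _ _ _ _ _ _ (I 0)).
  apply: runs_set => //=; first by lia.
  by split=> //; apply: same_update.
move=> si siM [Si si11]; apply: (runs_for M2 (I := I)) => //.
- by split=> //; apply: same_update.
- by move=> k s' _ _ _ [/loaded_same/(_ sl) - /(_ isT) /loaded_bound].
move=> k s0 kn s0M s0k [S0 H0].
have L0 : loaded s0 by apply: loaded_same S0 sl.
apply: (runs_sums (m := n.+1) s0M L0 s0k) => //.
- by move=> s' S; apply: loaded_bound; apply: loaded_same S L0.
- by move=> l ln; rewrite S0 // sn.
move=> s1 s1M S1 s1A s1B s1s.
have V : value s1 check_expr = ok k.+1.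
  rewrite /= s1A s1B s1s S1 // H0.
  rewrite (fixed_upto_eq (G := s v_cnt)) => [|l _]; last exact: S0.
  by rewrite mulnb /ok -(addn1 k) iotaD all_cat /= andbT.
apply: runs_set => //; rewrite V; first by case: (ok _) => //; lia.
split; first by rewrite /update /= S1.
split=> //.
do 2! [apply: same_update; first by []].
by apply: same_trans S1.
Qed.

(** The output array after the leading count: it starts with the list [w], and the
    next free position is in [v_top]. *)
Definition tape (s : memory) (w : seq nat) : Prop :=
  s v_top 0 = (size w).+1 /\ forall i, i < size w -> s v_out i.+1 = nth 0 w i.

Lemma tape_same L s s' w : (v_out \notin L) && (v_top \notin L) -> same L s s' ->
  tape s w -> tape s' w.
Proof.
by case/andP => L2 L12 S [s12 s2]; split=> [|i iw]; rewrite S // s2.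
Qed.

Lemma runs_emit e s w : bounded M s -> safe e -> tape s w -> value s e <= M ->
  (size w).+2 <= M -> runs M (Emit e) s (cost e + 9)
    (fun s' => [/\ tape s' (rcons w (value s e)), same [:: v_out; v_top] s s'
                 & s' v_out 0 = s v_out 0]).
Proof.
move=> sM se [s12 s2] eM wM.
apply: (@runs_weaken _ _ _ (cost e + 3 + 6) _ _ _ _ _ (fun _ _ H => H)); last by lia.
apply: (@runs_seq _ _ _ _ _ _ (eq (update s v_out (size w).+1 (value s e)))).
  apply: runs_set => //=; rewrite ?s12 //; lia.
move=> s' + E; rewrite -{s'}E => sM'.
apply: runs_set => //=; rewrite /update /= s12 addn1 //.
split=> //.
- split=> /=; first by rewrite size_rcons.
  move=> i; rewrite size_rcons ltnS nth_rcons => iw; rewrite eqSS.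
  by case: ltngtP iw => // iw _; rewrite s2.
by do 2! [apply: same_update; first by []].
Qed.

(** As [cycles n X] is the list of cycles that the two nested loops write, its size
    has to be known in advance for the leading count. *)
Lemma runs_output s w : bounded M s -> loaded s -> tape s w -> s v_cnt 0 = 0 ->
  size (cycles n (s v_cnt)) <= n -> size w + n + 3 <= M -> s v_out 0 < M ->
  runs M Output s (600 * (n.+1 * n.+1))
    (fun s' => [/\ tape s' (w ++ encode (cycles n (s v_cnt))),
       same [:: v_out; v_idx; v_len; v_sum; v_top; v_rep] s s'
       & s' v_out 0 = (s v_out 0).+1]).
Proof.
move=> sM sl sw X0 cn wM c0.
pose X := s v_cnt; pose cyc := cycles n X.
rewrite -/X -/cyc in cn *.
(* The loop runs over the lengths from [0], and [cycles] over those from [1]; the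
   length [0] contributes nothing. *)
pose flat k := flatten [seq nseq (X l) l | l <- iota 0 k].
have flatS k : flat k.+1 = flat k ++ nseq (X k) k.
  by rewrite /flat -(addn1 k) iotaD map_cat flatten_cat /= cats0.
have flat_cyc : flat n.+1 = cyc by rewrite /flat /= [X 0]X0.
have flat_le k : k <= n.+1 -> size (flat k) <= size cyc.
  move=> kn; rewrite -flat_cyc -(subnKC kn) /flat iotaD map_cat flatten_cat size_cat.
  exact: leq_addr.
have size_cyc : size cyc = \sum_(k < n.+1) X k.
  rewrite -flat_cyc; elim: (n.+1) => [|k IH]; first by rewrite big_ord0.
  by rewrite flatS size_cat IH size_nseq big_ord_recr.
pose w0 := rcons w (size cyc).
pose I k s' := [/\ tape s' (w0 ++ flat k),
  same [:: v_out; v_idx; v_len; v_sum; v_top; v_rep] s s'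
  & s' v_out 0 = s v_out 0].
apply: (@runs_weaken _ _ _ (n.+2 * 40 + (11 + (n.+2 * (n.+1 * 30 + 4 + 16) + 7))) _
  _ _ _ _ (fun _ _ H => H)); last by nia.
apply: (@runs_seq _ _ _ _ _ _
  (fun s' => s' v_sum 0 = size cyc /\ same [:: v_idx; v_sum] s s')).
  rewrite size_cyc; apply: (@runs_weaken _ _ _ _ _ _ _
    (runs_sum M2 (n := n.+1) (F := X) _ sM _ _ _ _ _)) => //.
  - move=> k s' S s'4; have L : loaded s' by apply: loaded_same S sl.
    by rewrite (loaded_bound L) /= s'4 S.
  - by rewrite -size_cyc (leq_trans cn) // ltnW.
  by rewrite leq_mul.
move=> s1 s1M [s1c S1].
apply: runs_seq.
  apply: (runs_emit (w := w) s1M) => //.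
  - exact: tape_same S1 sw.
  - by rewrite /= s1c (leq_trans cn) // ltnW.
  - by lia.
move=> s2 s2M [+ S2 s20]; rewrite [value _ _]/= s1c -/w0 => s2w.
have S02 : same [:: v_out; v_idx; v_sum; v_top] s s2.
  by apply: same_trans S2; last apply: (same_trans _ _ S1).
have s2l : loaded s2 by apply: loaded_same S02 sl.
apply: (@runs_seq _ _ _ _ _ _ (fun s' => s' v_len 0 = n.+1 /\ I n.+1 s')).
  apply: (runs_for M2 (I := I)) => //.
  - split; last by rewrite /update /= s20 S1.
      by rewrite cats0; apply: (tape_same (L := [:: v_len]) _ _ s2w) => //;
         apply: same_update.
    by apply: same_update => //; apply: same_trans S02.
  - by move=> k s' _ _ _ [_ /loaded_same/(_ sl) - /(_ isT) /loaded_bound].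
  move=> k s3 kn s3M s3k [s3w S3 s30].
  pose J j s' := [/\ tape s' (w0 ++ flat k ++ nseq j k),
    same [:: v_out; v_idx; v_len; v_sum; v_top; v_rep] s s',
    s' v_len 0 = k & s' v_out 0 = s v_out 0].
  have le_k : size (flat k) + X k <= size cyc.
    by have := flat_le _ kn; rewrite flatS size_cat size_nseq.
  apply: (@runs_weaken _ _ _ ((X k).+1 * (11 + 3 + 16)) _
    (fun s' => s' v_rep 0 = X k /\ J (X k) s')); last 2 first.
  - rewrite leq_mul //; lia.
  - move=> s' _ [_ [s'w S' s'5 s'0]]; split=> //; split.
    + rewrite flatS; apply: (tape_same (L := [:: v_len]) _ _ s'w) => //.
      exact: same_update.
    + exact: same_update.
    + by rewrite /update.
  apply: (runs_for M2 (I := J)) => //.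
  - lia.
  - split=> //.
    + by rewrite cats0; apply: (tape_same (L := [:: v_rep]) _ _ s3w) => //;
         apply: same_update.
    + exact: same_update.
  - by move=> j s' jX s'M s'13 [_ S' s'5 _]; rewrite /= s'5 S'.
  move=> j s' jX s'M s'13 [s'w S' s'5 s'0].
  apply: (@runs_weaken _ _ _ _ _ _ _ (runs_emit (e := Var v_len) s'M _ s'w _ _)) => //.
  - by rewrite /= s'5; lia.
  - by rewrite !size_cat size_rcons size_nseq; lia.
  move=> s4 s4M [+ S4 s40]; rewrite [value _ _]/= s'5 => s4w.
  split; first by rewrite S4.
  split.
  - have E : rcons (w0 ++ flat k ++ nseq j k) k = w0 ++ flat k ++ nseq j.+1 k.
      rewrite !rcons_cat; congr (_ ++ (_ ++ _)); by elim: (j) => //= i ->.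
    by rewrite -E; apply: (tape_same (L := [:: v_rep]) _ _ s4w) => //;
       apply: same_update.
  - by apply: same_update => //; apply: same_trans S4.
  - by rewrite /update /= S4.
  - by rewrite /update /= s40.
move=> s3 s3M [_ [s3w S3 s30]]; apply: runs_set => //=; rewrite s30 ?addn1 //.
split=> //.
- move: s3w; rewrite flat_cyc cat_rcons => -[s3q s3w]; split; first by rewrite /update.
  by move=> i /s3w; rewrite /update.
- exact: same_update.
Qed.

End Phases.

(** * Correctness of the program *)

Section Solver.
Variables (A B : cycsum) (a b : seq nat).
Hypothesis AB : basic_instance A B.
Hypothesis Ap : {in (supp A `\ 1)%fset, forall l, prime l}.
Hypotheses (aA : lists a A) (bB : lists b B).
Local Notation n := (nvertices B).
(* The input and the sums over it are at most [|A| + |B|], the sums over a candidate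
   have up to [n + 1] terms bounded by [n * n], and the output is shorter than
   [(n + 1) ^ 3]. *)
Local Notation M := ((nvertices A + n) ^ 4).

Let A0 := nvertices_gt0A AB.
Let B0 := nvertices_gt0B AB.

Let AM : nvertices A <= M.
Proof.
apply: leq_trans (leq_addr n _) _.
by rewrite -{1}[_ + _]expn1 leq_pexp2l //; lia.
Qed.

Let BM4 : n.+1 ^ 4 <= M.
Proof. by rewrite leq_exp2r // -add1n leq_add2r. Qed.

Let BM : n.+1 * (n.+1 * n.+1) <= M.
Proof. by apply: leq_trans BM4; rewrite !expnS expn0 muln1 !leq_mul //; nia. Qed.

Let M2 : 2 <= M. Proof. nia. Qed.

(** A candidate with [x] loops that passes the test is a solution, and if it fails
    there is none, as a solution with [x] loops would satisfy the same recurrence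
    and hence be equal to the candidate. *)
Lemma candidate_solution x X :
  (forall d, d < n.+1 -> X d = next_count A B x X d) ->
  if passes A B X then solution A B (cycsum_of n X) /\ cycsum_of n X 1 = x
  else forall Z, solution A B Z -> Z 1 <> x.
Proof.
move=> HX.
have X0 : X 0 = 0 by rewrite HX // /next_count mul0n.
case: ifP => [/allP ok|/negP fail Z AZ Z1].
  split; last by rewrite cycsum_ofE B0 HX //= /next_count mul1n addn0.
  apply/solutionP => d dn; rewrite cfixed_cycsum_of //.
  by apply/eqP/ok; rewrite mem_iota.
apply: fail; apply/allP => d; rewrite mem_iota ltnS => /= dn; apply/eqP.
rewrite -(proj1 (solutionP A B Z) AZ d dn); congr (_ * _).
rewrite (@cfixed_nvertices Z d n.+1) ?ltnS ?(solution_nvertices AB) //.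
apply: fixed_upto_eq => l ln.
by apply: (solution_unique AB Ap AZ) ln => j jn; rewrite Z1 HX.
Qed.

(** The invariant of the main loop: the output lists the solutions with fewer than
    [k] loops. The bounds on its size keep the pointer [v_top] below [M]. *)
Definition listed (k : nat) (s : memory) : Prop :=
  exists Xs xs, let w := flatten [seq encode x | x <- xs] in
  [/\ uniq Xs /\ (forall Z, Z \in Xs <-> solution A B Z /\ Z 1 < k),
      [seq seq_mset x | x <- xs] = [seq lengths X | X <- Xs],
      s v_out 0 = size xs /\ tape s w,
      size xs <= k & size w <= k * n.+1].

Lemma listed_same L s s' k : [&& v_out \notin L & v_top \notin L] -> same L s s' ->
  listed k s -> listed k s'.
Proof.
move=> L2 S [Xs [xs [H1 H2 [H3 H4] H5 H6]]]; exists Xs, xs; split=> //.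
case/andP: (L2) => L2' _; split; first by rewrite S.
exact: tape_same L2 S H4.
Qed.

(** The test at [0] reads [|A| * |X| = |B|]. *)
Lemma cycles_passes X : X 0 = 0 -> passes A B X -> size (cycles n X) <= n.
Proof.
move=> X0 /allP/(_ 0) - /(_ isT) /eqP; rewrite -!nvertices_cfixed => E.
apply: leq_trans (size_cycles _ X0) _; rewrite -[X in _ <= X]E.
exact: leq_pmull.
Qed.

Lemma runs_round s k :
  bounded M s -> size a <= n -> loaded B a b s -> s v_x 0 = k -> k <= n ->
  listed k s ->
  runs M Round s (2000 * (n.+1 * n.+1))
    (fun s' => s' v_x 0 = k /\ loaded B a b s' /\ listed k.+1 s').
Proof.
move=> sM an sl s10 kn Ls.
apply: (@runs_weaken _ _ _ (600 * (n.+1 * n.+1) + (600 * (n.+1 * n.+1) +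
  (2 + 600 * (n.+1 * n.+1)).+1)) _ _ _ _ _ (fun _ _ H => H)); last by nia.
apply: runs_seq.
  exact: (runs_candidate aA bB A0 B0 AM BM an sM sl s10 kn).
move=> s1 s1M [S1 HX].
have s1l : loaded B a b s1 by apply: loaded_same S1 sl.
have := candidate_solution HX; set X := s1 v_cnt in HX *.
have X0 : X 0 = 0 by rewrite HX // /next_count mul0n.
have Xn l : l < n.+1 -> s1 v_cnt l <= n.
  by move=> ln; rewrite [s1 v_cnt l]HX // next_count_le.
move=> HP; apply: runs_seq.
  exact: (runs_check aA bB A0 B0 AM BM an s1M s1l Xn).
move=> s2 s2M [S2 s2ok].
have S02 : same [:: v_cnt; v_idx; v_len; v_fixA; v_fixB; v_sum; v_ok] s s2.
  by apply: same_trans S2; last apply: (same_trans _ _ S1).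
have s2l : loaded B a b s2 by apply: loaded_same S02 sl.
have Ls2 : listed k s2 by apply: listed_same S02 Ls.
apply: runs_if => //; rewrite [value _ _]/= s2ok -/X; case: ifP HP => //= P HP _.
  have [Xs [xs [[uXs HXs] E [c0 tp] sxs sw]]] := Ls2.
  set w := flatten _ in tp sw.
  have cn := cycles_passes X0 P.
  have Ecyc : cycles n (s2 v_cnt) = cycles n X.
    by congr flatten; apply: eq_map => l; rewrite S2.
  apply: (@runs_weaken _ _ _ _ _ _ _
    (runs_output A0 B0 AM BM an s2M s2l tp _ _ _ _)) => //.
  - by rewrite S2.
  - by rewrite Ecyc.
  - have wn : size w <= n * n.+1 by apply: leq_trans sw _; rewrite leq_mul.
    apply: leq_trans BM; move: B0 wn; move: (n) (size w) => v u v0 wn.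
    have v2 : v <= v * v by rewrite leq_pmulr.
    have v3 : v * v <= v * v * v by rewrite leq_pmulr.
    by lia.
  - by rewrite c0 (leq_ltn_trans sxs) // (leq_ltn_trans kn) //; nia.
  move=> s3 s3M; rewrite Ecyc => -[tp3 S3 c3].
  split; first by rewrite S3 // S02.
  split; first by apply: loaded_same S3 s2l.
  have [sol Z1] := HP.
  exists (rcons Xs (cycsum_of n X)), (rcons xs (cycles n X)).
  have wE : flatten [seq encode x | x <- rcons xs (cycles n X)] =
      w ++ encode (cycles n X).
    by rewrite map_rcons -cats1 flatten_cat /= cats0.
  rewrite /= wE; split=> //.
  - split.
      rewrite rcons_uniq uXs andbT; apply/negP => /HXs [_].
      by rewrite Z1 ltnn.
    move=> Z; rewrite mem_rcons inE; split.
      case/orP => [/eqP ->|/HXs[? ?]]; first by rewrite Z1.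
      by split=> //; apply: ltnW.
    move=> [AZ]; rewrite ltnS leq_eqVlt => /orP[/eqP Zk|Zk]; apply/orP.
      by left; apply/eqP/(solution_inj AB Ap AZ sol); rewrite Z1.
    by right; apply/HXs.
  - by rewrite !map_rcons E.
  - by rewrite c3 c0 size_rcons.
  - by rewrite size_rcons.
  by rewrite size_cat mulSn addnC leq_add.
apply: runs_skip => //.
split; first by rewrite S02.
split=> //.
have [Xs [xs [[uXs HXs] E C sxs sw]]] := Ls2.
exists Xs, xs; split=> //.
- split=> // Z; rewrite HXs; split=> [[AZ Zk]|[AZ]]; first by split=> //; apply: ltnW.
  rewrite ltnS leq_eqVlt => /orP[/eqP Zk|//]; by case: (HP _ AZ).
- exact: leqW.
- by apply: leq_trans sw _; rewrite leq_mul.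
Qed.

Lemma input_bounded : bounded M (input a b).
Proof.
have mem C c i : lists c C -> nth 0 c i <= nvertices C.
  move=> cC; case: (ltnP i (size c)) => ic; last by rewrite nth_default.
  rewrite nvertices_cfixed -(fixed_lists _ cC) /fixed.
  under eq_bigl => l do rewrite dvdn0.
  by rewrite (big_rem _ (mem_nth 0 ic)) leq_addr.
have code C c i : lists c C -> nth 0 (encode c) i <= nvertices C.
  by move=> cC; case: i => [|i] /=; [exact: size_lists | exact: mem].
move=> [|[|r]] i //=.
- by apply: leq_trans (code _ _ _ aA) AM.
- by apply: leq_trans (code _ _ _ bB) _; nia.
Qed.

Lemma runs_solver S : solution_set A B S ->
  runs M solver (input a b) (30 * 1000 * n ^ 3) (outputs^~ S).
Proof.
move=> HS; have bn := size_lists bB.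
apply: (@runs_weaken _ _ _
  (n.+1 * 60 + (5 + (3 + n.+2 * (2000 * (n.+1 * n.+1) + 4 + 16))).+1)
  _ _ _ _ _ (fun _ _ H => H)); last first.
  have n0 := B0; have -> : n ^ 3 = n * (n * n) by rewrite !expnS expn0 muln1.
  move: (n) n0 => m m0.
  have h1 : m <= m * (m * m) by nia.
  have h2 : m.+2 * (m.+1 * m.+1) <= 12 * (m * (m * m)) by nia.
  by lia.
apply: (@runs_seq _ _ _ _ _ _
  (fun s => s v_nB 0 = n /\ same [:: v_idx; v_nB] (input a b) s)).
  apply: (@runs_weaken _ _ _ _ _ _ _
    (runs_fixed M2 (c := b) _ _ input_bounded _ _)) => //.
  - by rewrite (fixed_lists _ bB) -nvertices_cfixed; nia.
  - by rewrite leq_mul.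
  by move=> s _ [+ S1]; rewrite (fixed_lists _ bB) -nvertices_cfixed.
move=> s1 s1M [s19 S1].
have l1 : loaded B a b s1 by split=> [i|i|//]; rewrite S1.
apply: runs_if => //=; rewrite s19 S1 //= => an; last first.
  apply: runs_skip => //.
  exists [::], [::]; split=> //; last by rewrite /mkseq /= S1.
  have -> : S = fset0; last by [].
  apply/fsetP => Z; rewrite inE; apply/negP => /HS AZ.
  (* A solution would have a vertex, whence [|A| <= |B|]. *)
  have Z0 : 0 < nvertices Z.
    by have := B0; rewrite -(nvertices_solution AZ) muln_gt0 => /andP[].
  case: leqP an => //; rewrite ltnNge => /negP[].
  apply: leq_trans (size_lists aA) _.
  by rewrite -(nvertices_solution AZ); apply: leq_pmulr.
have {}an : size a <= n by move: an; case: leqP.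
pose I k s := loaded B a b s /\ listed k s.
apply: (@runs_seq _ _ _ _ _ _ (I 0)).
  apply: runs_set => //=; first by nia.
  split; first by case: l1 => ? ? ?; split.
  exists [::], [::]; split=> //=; split=> //; first by move=> Z; split=> // -[].
  by rewrite /update /= (S1 v_out).
move=> s2 s2M [l2 L2].
apply: (@runs_weaken _ _ _ _ _ (fun s => s v_x 0 = n.+1 /\ I n.+1 s));
  first apply: (runs_for M2 (I := I)) => //.
- nia.
- by move=> k s _ _ _ [ls _]; rewrite (loaded_bound ls).
- move=> k s kn sM s10 [ls Ls].
  apply: runs_weaken; first exact: (runs_round sM an ls s10 kn Ls).
  - exact: leqnn.
  by move=> s' _ [s'10 [ls' Ls']]; split.
- exact: leqnn.
move=> s sM [_ [_ [Xs [xs [[uXs HXs] E [c0 [_ tp]] _ _]]]]].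
exists Xs, xs; split=> //.
  apply: uniq_perm => // [|Z]; first exact: fset_uniq.
  apply/idP/idP => [/HXs[AZ _]|/HS AZ]; first exact/HS.
  apply/HXs; split=> //; rewrite ltnS (leq_trans _ (solution_nvertices AB AZ)) //.
  by have := leq_nvertices Z 1; rewrite mul1n.
apply: (@eq_from_nth _ 0); first by rewrite size_mkseq.
move=> [|i]; rewrite size_mkseq => i_lt; rewrite nth_mkseq //=.
exact: tp.
Qed.
End Solver.

Theorem mainTheorem9 :
  let prime_instance (A B : cycsum) :=
    basic_instance A B /\ {in (supp A `\ 1%N)%fset, forall l : nat, prime l} in
  solutions_computable_in prime_instance (fun _ B => (nvertices B ^ 4)%N) /\
  forall A B : cycsum, prime_instance A B ->
    exists S : {fset cycsum},
      solution_set A B S /\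
      ((#|` S|)%:R <= (nvertices B)%:R / (nvertices A)%:R :> rat)%R.
Proof.
move=> prime_instance; split; last first.
  move=> A B [AB Ap]; have [S HS] := solutions_finite AB.
  by exists S; split=> //; apply: solutions_bound.
(* Cells are at most [(|A| + |B|) ^ 4], values at most the tenth power of that. *)
exists solver, 40, (30 * 1000) => A B [AB Ap]; have [S HS] := solutions_finite AB.
exists S; split=> // a b aA bB.
have [t [s [ex tT _ out]]] := runs_solver AB Ap aA bB HS.
have tT' : t <= 30 * 1000 * nvertices B ^ 4.
  apply: leq_trans tT _; rewrite leq_mul2l; apply/orP; right.
  by rewrite leq_pexp2l // (nvertices_gt0B AB).
by exists t, s; split=> //; rewrite -[40]/(4 * 10) expnM.
Qed.
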